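(* Let $G$ be a locally compact group, $\phi$ a continuous endomorphism of $G$, and $U$ a compact open subgroup of $G$ that is topologically quasinormal in $G$. Then $$H_{alg}(\phi,U)=\log[U^-:\phi^{-1}U^-].$$
   Context: All topological groups are Hausdorff. A closed subgroup $N$ of a topological group $G$ is topologically quasinormal if $\overline{NL}=\overline{LN}$ for every closed subgroup $L$ of $G$. Definition of $U^-$: put $U^{(0)}=U$, $U^{(n+1)}=U\cdot\phi^{-1}(U^{(n)})$ for $n\geq 0$, and $U^-=\bigcup_{n\geq 0}U^{(n)}$. Under the hypotheses the $U^{(n)}$ form an increasing sequence of open subgroups, $U^-$ is an open subgroup of $G$, $\phi^{-1}U^-\leq U^-$, and the index $[U^-:\phi^{-1}U^-]$ is finite. Entropy with respect to $U$: let $\mu$ be a right Haar measure on $G$. For $n\geq 1$ put $T_n(\phi,U)=U\cdot\phi(U)\cdots\phi^{n-1}(U)$ and $H_{alg}(\phi,U)=\limsup_{n\to\infty}\frac{\log\mu(T_n(\phi,U))}{n}$. *)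

(* Defs.v *)
From HB Require Import structures.
From mathcomp Require Import all_boot all_order all_algebra.
From mathcomp Require Import all_classical all_reals all_analysis.
Import Order.TTheory GRing.Theory Num.Theory numFieldNormedType.Exports.

Set Implicit Arguments.
Unset Strict Implicit.
Unset Printing Implicit Defensive.

Local Open Scope classical_set_scope.
Local Open Scope ring_scope.

HB.mixin Record Group_isTopological G of monoid.Group G & Topological G := {
  mulg_continuous : continuous (fun xy : G * G => xy.1 * xy.2)%g ;
  invg_continuous : continuous (fun x : G => x^-1)%g
}.

(* The separation axiom is not part of the structure. *)
#[short(type="topologicalGroupType")]
HB.structure Definition TopologicalGroup :=
  {G of monoid.Group G & Topological G & Group_isTopological G}.

Definition set_mulg (G : groupType) (A B : set G) : set G :=
  [set (x * y)%g | x in A & y in B].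

Definition subgroup (G : groupType) (H : set G) : Prop := group_closed (mem H).

Definition topologically_quasinormal (G : topologicalGroupType) (N : set G) :
    Prop :=
  [/\ subgroup N, closed N &
      forall L : set G, subgroup L -> closed L ->
        closure (set_mulg N L) = closure (set_mulg L N)].

(* The index [K : H] of a subgroup H of K, as the number of left cosets xH with
   x in K; it is +oo when there are infinitely many of them. *)
Definition group_index (R : realType) (G : groupType) (K H : set G) : \bar R :=
  counting [set set_mulg [set x] H | x in K].

Fixpoint Uapprox (G : groupType) (phi : G -> G) (U : set G) (n : nat) : set G :=
  if n is m.+1 then set_mulg U (phi @^-1` Uapprox phi U m) else U.

Definition Uminus (G : groupType) (phi : G -> G) (U : set G) : set G :=
  \bigcup_n Uapprox phi U n.

(* G equipped with its Borel sigma-algebra; measurable types are pointed in the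
   library, and the identity of G serves as the point. *)
Definition borel (G : topologicalGroupType) : Type := G.

Section borel_instances.
Variable G : topologicalGroupType.

HB.instance Definition _ := Choice.on (borel G).
HB.instance Definition _ := isPointed.Build (borel G) (1%g : G).
HB.instance Definition _ := @isMeasurable.Build (sigma_display (@open G))
  (borel G) <<s @open G >> (@sigma_algebra0 _ setT (@open G))
  (@sigma_algebraC (borel G) (@open G))
  (@sigma_algebra_bigcup _ setT (@open G)).

End borel_instances.

(* A right Haar measure: a nonzero Radon measure on the Borel sets which is
   invariant under right translations. *)
Record right_Haar (R : realType) (G : topologicalGroupType)
    (mu : {measure set (borel G) -> \bar R}) : Prop := {
  Haar_neq0 : (mu setT != 0)%E ;
  Haar_compact : forall K : set G, compact K -> (mu K < +oo)%E ;
  Haar_outer : forall A : set (borel G), measurable A ->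
    mu A = ereal_inf [set mu V | V in [set V : set G | open V /\ A `<=` V]] ;
  Haar_inner : forall V : set G, open V ->
    mu V = ereal_sup [set mu K | K in [set K : set G | compact K /\ K `<=` V]] ;
  Haar_right_invariant :
    forall (x : G) (A : set (borel G)), measurable A ->
    mu (set_mulg A [set x]) = mu A
}.

(* T_n = U . phi(U) ... phi^(n-1)(U); the empty product T_0 is the trivial
   group. *)
Definition trajectory (G : groupType) (phi : G -> G) (U : set G) (n : nat) :
    set G :=
  \big[@set_mulg G/[set 1%g]]_(i < n) (iter i phi @` U).

(* The value at n = 0 is immaterial, as a limsup ignores it. *)
Definition H_alg (R : realType) (G : topologicalGroupType)
    (mu : {measure set (borel G) -> \bar R})
    (phi : G -> G) (U : set G) : \bar R :=
  limn_esup (fun n => lne (mu (trajectory phi U n)) * (n%:R^-1)%:E)%E.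

(* Main.v *)
Require Import Defs.
From HB Require Import structures.
From mathcomp Require Import all_boot all_order all_algebra finmap.
From mathcomp Require Import all_classical all_reals all_analysis ring.
Import Order.TTheory GRing.Theory Num.Theory numFieldNormedType.Exports.
Local Open Scope ring_scope.
Local Open Scope classical_set_scope.

(** The argument compares two sequences of subgroups through counting of
    cosets.

    An open subgroup U makes every product UL clopen, since UL is a union of
    right cosets of U.  For topologically quasinormal U the closures in the
    definition can therefore be dropped, and UL = LU is a subgroup for every
    closed subgroup L ([quasinormal_mulgC]).  Applied to the preimages of the
    U^(n), which are closed, this makes the U^(n) open subgroups; applied to the
    images of the trajectories T_n, which are compact, it makes the T_n with
    n > 0 compact open subgroups, because T_(n+1) = U phi(T_n).

    The two sequences are linked by the identity phi^(-n)(T_(n+1)) = U^(n)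
    ([preimage_trajectory]): as T_(n+1) = T_n phi^n(U), its preimage under phi^n
    is, for n > 0, phi^(-n)(T_n) U = phi^(-1)(U^(n-1)) U, and these two factors
    commute.

    Now T_(n+2) is a union of right cosets of T_(n+1) with representatives
    phi^(n+1)(u), for u in U, and two elements of U represent the same coset
    when their quotient lies in phi^(-1)(U^(n)).  On the other side
    U^- = U phi^(-1)(U^-), so the cosets of phi^(-1)(U^-) in U^- are represented
    by U as well, modulo the intersection of U with phi^(-1)(U^-).  The groups
    phi^(-1)(U^(n)) increase to phi^(-1)(U^-) and are open, so by compactness
    they have the same intersection with U as phi^(-1)(U^-) when n is large
    ([Uapprox_stabilizes]).  Hence [T_(n+2) : T_(n+1)] is equal to
    k = [U^- : phi^(-1)(U^-)] for all large n ([card_rcosets_trajectory]).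

    By right invariance the measure of T_(n+2) is then k times that of T_(n+1)
    ([mu_trajectory_growth]).  These measures are positive and finite, so their
    logarithms grow by log k at each step, and the upper limit defining the
    entropy is a limit, equal to log k ([ln_geometric_cvg]). *)

Set Implicit Arguments.
Unset Strict Implicit.
Unset Printing Implicit Defensive.

(** * Products of subsets and subgroups *)

Section set_product.
Variable G : groupType.
Implicit Types A B C : set G.

Lemma set_mulgA : associative (@set_mulg G).
Proof.
move=> A B C; apply/seteqP; split=> [_ [a Aa [_ [b Bb [c Cc <-]] <-]]|].
  by exists (a * b)%g; [exists a => //; exists b|exists c; rewrite // mulgA].
move=> _ [_ [a Aa [b Bb <-]] [c Cc <-]].
by exists a => //; exists (b * c)%g; [exists b => //; exists c|rewrite mulgA].
Qed.

Lemma set_mul1g : left_id [set 1%g] (@set_mulg G).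
Proof.
move=> A; apply/seteqP; split=> [_ [_ -> [a Aa <-]]|a Aa].
  by rewrite mul1g.
by exists 1%g => //; exists a => //; rewrite mul1g.
Qed.

Lemma set_mulg1 : right_id [set 1%g] (@set_mulg G).
Proof.
move=> A; apply/seteqP; split=> [_ [a Aa [_ -> <-]]|a Aa].
  by rewrite mulg1.
by exists a => //; exists 1%g => //; rewrite mulg1.
Qed.

(** Trajectories are iterated products, so the monoid law gives access to the
    splitting lemmas for big operators. *)
HB.instance Definition _ :=
  Monoid.isLaw.Build (set G) [set 1%g] (@set_mulg G)
    set_mulgA set_mul1g set_mulg1.

End set_product.

Section morphism.
Variables (G H : groupType) (f : {multiplicative G -> H}).

Lemma multiplicative1 : f 1%g = 1%g.
Proof. by apply: (mulgI (f 1%g)); rewrite -gmulfM !mulg1. Qed.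

Lemma multiplicativeV x : f x^-1%g = (f x)^-1%g.
Proof.
by apply: (mulgI (f x)); rewrite -gmulfM !mulgV multiplicative1.
Qed.

Lemma image_set_mulg (A B : set G) :
  f @` set_mulg A B = set_mulg (f @` A) (f @` B).
Proof.
apply/seteqP; split=> [_ [_ [a Aa [b Bb <-]] <-]|].
  by exists (f a); [exists a|exists (f b); [exists b|rewrite gmulfM]].
move=> _ [_ [a Aa <-] [_ [b Bb <-] <-]].
by exists (a * b)%g; [exists a => //; exists b|rewrite gmulfM].
Qed.

(** If f x = a f(b) then f maps x b^-1 to a, so a factor which is an image can
    be pulled out of a preimage. *)
Lemma preimage_set_mulg_image (A : set H) (B : set G) :
  f @^-1` set_mulg A (f @` B) = set_mulg (f @^-1` A) B.
Proof.
apply/seteqP; split=> [x [a Aa [_ [b Bb <-] abE]]|_ [a Aa [b Bb <-]]].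
  exists (x * b^-1)%g; last by exists b => //; rewrite mulgVK.
  by rewrite /= gmulfM multiplicativeV -abE mulgK.
by exists (f a) => //; exists (f b); [exists b|rewrite gmulfM].
Qed.

End morphism.

Section iteration.
Variables (G : groupType) (phi : {multiplicative G -> G}) (n : nat).

Let iterM : {morph iter n phi : x y / (x * y)%g}.
Proof. by elim: n => // m IH x y /=; rewrite IH gmulfM. Qed.

HB.instance Definition _ := isMultiplicative.Build G G (iter n phi) iterM.

End iteration.

Section subgroup_theory.
Variable G : groupType.
Implicit Types (H K : set G) (x y : G).

Lemma subgroupP H :
  subgroup H <-> H 1%g /\ forall x y, H x -> H y -> H (x * y^-1)%g.
Proof.
split=> [[H1 HV]|[H1 HV]]; split.
- by move: H1; rewrite inE.
- by move=> x y Hx Hy; apply/set_mem/HV; apply/mem_set.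
- by apply/mem_set.
- by move=> x y /set_mem Hx /set_mem Hy; apply/mem_set/HV.
Qed.

Lemma subgroup1 H : subgroup H -> H 1%g.
Proof. by case/subgroupP. Qed.

Lemma subgroupV H x : subgroup H -> H x -> H x^-1%g.
Proof. by case/subgroupP=> H1 HV Hx; rewrite -[x^-1%g]mul1g; apply: HV. Qed.

Lemma subgroupM H x y : subgroup H -> H x -> H y -> H (x * y)%g.
Proof.
move=> sH Hx Hy; rewrite -[y]invgK; case/subgroupP: (sH) => _; apply=> //.
exact: subgroupV.
Qed.

Lemma subgroup_mulgg H : subgroup H -> set_mulg H H = H.
Proof.
move=> sH; apply/seteqP; split=> [_ [x Hx [y Hy <-]]|x Hx].
  exact: subgroupM.
by exists 1%g; [exact: subgroup1|exists x => //; rewrite mul1g].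
Qed.

Lemma subgroup_set_mulg H K : subgroup H -> subgroup K ->
  set_mulg H K = set_mulg K H -> subgroup (set_mulg H K).
Proof.
move=> sH sK HKC; apply/subgroupP; split.
  exists 1%g; first exact: subgroup1.
  by exists 1%g; [exact: subgroup1|rewrite mulg1].
move=> _ _ [h Hh [k Kk <-]] [h' Hh' [k' Kk' <-]].
have : set_mulg K H (k * k'^-1 * h'^-1)%g.
  exists (k * k'^-1)%g; first exact: (subgroupM sK Kk (subgroupV sK Kk')).
  by exists h'^-1%g; first exact: subgroupV.
rewrite -HKC => -[a Ha [b Kb abE]].
exists (h * a)%g; first exact: subgroupM.
by exists b => //; rewrite invgM -!mulgA abE !mulgA.
Qed.

(** Taking inverses turns an inclusion of LH in HL into the reverse one. *)
Lemma subgroup_mulgC H K : subgroup H -> subgroup K ->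
  set_mulg K H `<=` set_mulg H K -> set_mulg H K = set_mulg K H.
Proof.
move=> sH sK KH; apply/seteqP; split=> // _ [h Hh [k Kk <-]].
have [|h' Hh' [k' Kk' E]] := KH (k^-1 * h^-1)%g.
  by exists k^-1%g; [exact: subgroupV|exists h^-1%g => //; exact: subgroupV].
exists k'^-1%g; first exact: subgroupV.
exists h'^-1%g; first exact: subgroupV.
by rewrite -invgM E invgM !invgK.
Qed.

Lemma subgroup_image (f : {multiplicative G -> G}) H :
  subgroup H -> subgroup (f @` H).
Proof.
move=> sH; apply/subgroupP; split.
  by exists 1%g; [exact: subgroup1|exact: multiplicative1].
move=> _ _ [x Hx <-] [y Hy <-].
exists (x * y^-1)%g; first exact: (subgroupM sH Hx (subgroupV sH Hy)).
by rewrite gmulfM multiplicativeV.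
Qed.

Lemma subgroup_preimage (f : {multiplicative G -> G}) H :
  subgroup H -> subgroup (f @^-1` H).
Proof.
move=> sH; apply/subgroupP; split.
  by rewrite /= multiplicative1; exact: subgroup1.
move=> x y Hx Hy.
by rewrite /= gmulfM multiplicativeV; apply: subgroupM => //; apply: subgroupV.
Qed.

Lemma subgroup_bigcup (F : nat -> set G) : (forall n, subgroup (F n)) ->
  {homo F : m n / (m <= n)%N >-> m `<=` n} -> subgroup (\bigcup_n F n).
Proof.
move=> sF Fmono; apply/subgroupP; split.
  by exists 0%N => //; exact: subgroup1.
move=> x y [m _ Fx] [n _ Fy]; exists (maxn m n) => //.
apply: subgroupM; [exact: sF|exact: (Fmono _ _ (leq_maxl m n))|].
by apply: subgroupV; [exact: sF|exact: (Fmono _ _ (leq_maxr m n))].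
Qed.

Lemma lcoset_eqP H x y : subgroup H ->
  set_mulg [set x] H = set_mulg [set y] H <-> H (x^-1 * y)%g.
Proof.
move=> sH; split=> [xyH|Hxy].
  have : set_mulg [set x] H y.
    rewrite xyH; exists y => //; exists 1%g; first exact: subgroup1.
    by rewrite mulg1.
  by move=> [_ -> [h Hh <-]]; rewrite mulKg.
apply/seteqP; split=> [_ [_ -> [h Hh <-]]|_ [_ -> [h Hh <-]]].
  exists y => //; exists ((x^-1 * y)^-1 * h)%g.
    by apply: subgroupM => //; apply: subgroupV.
  by rewrite invgM invgK !mulgA mulgV mul1g.
exists x => //; exists (x^-1 * y * h)%g; first exact: subgroupM.
by rewrite !mulgA mulgV mul1g.
Qed.

Lemma rcosetP H x y : set_mulg H [set x] y <-> H (y * x^-1)%g.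
Proof.
split=> [[h Hh [_ -> <-]]|Hyx]; first by rewrite mulgK.
by exists (y * x^-1)%g => //; exists x; rewrite // mulgVK.
Qed.

Lemma rcoset_refl H x : subgroup H -> set_mulg H [set x] x.
Proof. by move=> sH; apply/rcosetP; rewrite mulgV; exact: subgroup1. Qed.

Lemma rcoset_eqP H x y : subgroup H ->
  set_mulg H [set x] = set_mulg H [set y] <-> H (x * y^-1)%g.
Proof.
move=> sH; split=> [xyH|Hxy].
  by apply/rcosetP; rewrite -xyH; exact: rcoset_refl.
apply/seteqP; split=> z /rcosetP Hz; apply/rcosetP.
  have -> : (z * y^-1 = z * x^-1 * (x * y^-1))%g by rewrite mulgA mulgVK.
  exact: subgroupM.
have -> : (z * x^-1 = z * y^-1 * (x * y^-1)^-1)%g.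
  by rewrite invgM invgK mulgA mulgVK.
by apply: subgroupM => //; apply: subgroupV.
Qed.

End subgroup_theory.

(** * Open subgroups and topological quasinormality *)

Section topology.
Variable G : topologicalGroupType.
Implicit Types (U A L : set G).

Lemma continuous_mulgr (g : G) : continuous (fun x : G => (x * g)%g).
Proof.
move=> x.
apply: (@continuous_comp _ _ _ (fun x : G => (x, g)) (fun p => p.1 * p.2)%g).
  by apply: cvg_pair; [exact: cvg_id|exact: cvg_cst].
exact: mulg_continuous.
Qed.

Lemma open_rcoset U x : open U -> open (set_mulg U [set x]).
Proof.
move=> oU; have -> : set_mulg U [set x] = (fun y => y * x^-1)%g @^-1` U.
  by apply/seteqP; split=> y /rcosetP.
by apply: open_comp => // y _; exact: continuous_mulgr.
Qed.

Lemma open_saturated U A : open U -> subgroup U ->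
  set_mulg U A `<=` A -> open A.
Proof.
move=> oU sU UA; have -> : A = \bigcup_(x in A) set_mulg U [set x].
  apply/seteqP; split=> [x Ax|y [x Ax [u Uu [_ -> <-]]]].
    by exists x => //; exact: rcoset_refl.
  by apply: UA; exists u => //; exists x.
by apply: bigcup_open => x _; exact: open_rcoset.
Qed.

(** Right cosets of an open subgroup are neighbourhoods, so a point adherent to
    a union A of such cosets lies in a coset meeting A. *)
Lemma closed_saturated U A : open U -> subgroup U ->
  set_mulg U A `<=` A -> closed A.
Proof.
move=> oU sU UA x Ax.
have [|y [Ay /rcosetP Uy]] := Ax (set_mulg U [set x]).
  by apply: open_nbhs_nbhs; split; [exact: open_rcoset|exact: rcoset_refl].
apply: UA; exists (y * x^-1)^-1%g; first exact: subgroupV.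
by exists y => //; rewrite invgM invgK mulgVK.
Qed.

(** UL is closed as a union of cosets of the open subgroup U, so LU, which lies
    in the closure of UL, lies in UL. *)
Lemma quasinormal_mulgC U L : open U -> topologically_quasinormal U ->
  subgroup L -> closed L -> set_mulg U L = set_mulg L U.
Proof.
move=> oU [sU _ qU] sL cL; apply: subgroup_mulgC => //.
have cUL : closed (set_mulg U L).
  by apply: (closed_saturated oU sU); rewrite set_mulgA subgroup_mulgg.
rewrite [X in _ `<=` X](iffLR (closure_id _) cUL) qU //.
exact: subset_closure.
Qed.

Lemma compact_set_mulg (A B : set G) :
  compact A -> compact B -> compact (set_mulg A B).
Proof.
move=> cA cB.
have -> : set_mulg A B = (fun p => p.1 * p.2)%g @` (A `*` B).
  apply/seteqP; split=> [_ [a Aa [b Bb <-]]|_ [[a b] [/= Aa Bb] <-]].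
    by exists (a, b).
  by exists a => //; exists b.
apply: continuous_compact; last exact: compact_setX.
by apply: continuous_subspaceT => p; exact: mulg_continuous.
Qed.

End topology.

Section dynamics.
Variables (G : topologicalGroupType) (phi : {multiplicative G -> G}).
Variable U : set G.
Hypotheses (phi_continuous : continuous phi) (sU : subgroup U) (oU : open U).
Hypothesis qU : topologically_quasinormal U.

(** * The subgroups exhausting U^- *)

Local Notation UA := (Uapprox phi U).
Local Notation T := (trajectory phi U).

(** Stability under left multiplication by U is carried along because it makes
    U^(n), hence its preimage, closed, as quasinormality requires. *)
Lemma Uapprox_subgroup n : subgroup (UA n) /\ set_mulg U (UA n) `<=` UA n.
Proof.
elim: n => [|n [sUn UUn]] /=.
  by split=> //; rewrite subgroup_mulgg.
have sP : subgroup (phi @^-1` UA n) by exact: subgroup_preimage.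
split; last by rewrite set_mulgA subgroup_mulgg.
apply: subgroup_set_mulg => //; apply: quasinormal_mulgC => //.
apply: closed_comp => //; exact: (closed_saturated oU sU UUn).
Qed.

Lemma preimage_Uapprox_mulgC n :
  set_mulg U (phi @^-1` UA n) = set_mulg (phi @^-1` UA n) U.
Proof.
have [sUn UUn] := Uapprox_subgroup n.
apply: quasinormal_mulgC => //; first exact: subgroup_preimage.
apply: closed_comp => //; exact: (closed_saturated oU sU UUn).
Qed.

Lemma subset_UapproxS n : UA n `<=` UA n.+1.
Proof.
elim: n => [|n IH] x /=.
  move=> Ux; exists x => //; exists 1%g; last by rewrite mulg1.
  by rewrite /= multiplicative1; exact: subgroup1.
by move=> [u Uu [y /IH Uy <-]]; exists u => //; exists y.
Qed.

Lemma subset_Uapprox : {homo UA : m n / (m <= n)%N >-> m `<=` n}.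
Proof.
apply: homo_leq; first exact: subset_refl; last exact: subset_UapproxS.
by move=> B A C; exact: subset_trans.
Qed.

Lemma Uminus_subgroup : subgroup (Uminus phi U).
Proof.
apply: subgroup_bigcup; last exact: subset_Uapprox.
by move=> n; case: (Uapprox_subgroup n).
Qed.

Lemma subset_Uminus : U `<=` Uminus phi U.
Proof. by move=> x Ux; exists 0%N. Qed.

(** Consequently U contains representatives of all cosets of the preimage of
    U^- in U^-. *)
Lemma UminusE : Uminus phi U = set_mulg U (phi @^-1` Uminus phi U).
Proof.
apply/seteqP; split=> [x [n _ /subset_UapproxS[u Uu [y Uy <-]]]|].
  by exists u => //; exists y => //; exists n.
by move=> _ [u Uu [y [n _ Uy] <-]]; exists n.+1 => //; exists u => //; exists y.
Qed.

Lemma open_preimage_Uapprox n : open (phi @^-1` UA n).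
Proof.
apply: open_comp => [x _|]; first exact: phi_continuous.
by case: (Uapprox_subgroup n) => _; exact: open_saturated.
Qed.

(** The preimages of the U^(n) are an increasing open cover of the compact set
    of those points of U which phi maps to U^-; hence one of them is enough. *)
Lemma Uapprox_stabilizes : compact U -> \forall n \near \oo,
  forall x, U x -> UA n (phi x) <-> Uminus phi U (phi x).
Proof.
move=> cU; set W := phi @^-1` Uminus phi U.
have oW : open W.
  rewrite /W preimage_bigcup; apply: bigcup_open => n _.
  exact: open_preimage_Uapprox.
have sW : subgroup W by apply: subgroup_preimage; exact: Uminus_subgroup.
have cW : closed W by apply: (closed_saturated oW sW); rewrite subgroup_mulgg.
have cUW : compact (U `&` W) by exact: compact_closedI.
have /(_ nat \oo (fun n x => UA n (phi x)) _) H :=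
  (iffLR (compact_near_coveringP _) cUW).
have : \forall n \near \oo, U `&` W `<=` (fun x => UA n (phi x)).
  apply: H => x [Ux [n _ Un]].
  exists (phi @^-1` UA n, [set m | (n <= m)%N]).
    split; last by exists n.
    by apply: open_nbhs_nbhs; split=> //; exact: open_preimage_Uapprox.
  by move=> [y m] /= [Uy nm]; exact: (subset_Uapprox nm).
apply: filterS => n Hn x Ux; split=> [Un|Wx]; first by exists n.
exact: Hn.
Qed.

(** * The trajectories *)

Lemma trajectory_recr n :
  T n.+1 = set_mulg (T n) (iter n phi @` U).
Proof. by rewrite /trajectory big_ord_recr. Qed.

Lemma trajectory1 : T 1%N = U.
Proof. by rewrite trajectory_recr /trajectory big_ord0 set_mul1g image_id. Qed.

(** Splitting off the first factor exhibits T_(n+2) as the product of U with the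
    image of T_(n+1), which is a closed subgroup; this is the form in which
    quasinormality applies. *)
Lemma trajectory_recl n : T n.+2 = set_mulg U (phi @` T n.+1).
Proof.
elim: n => [|n IH]; first by rewrite trajectory_recr trajectory1.
rewrite [in RHS]trajectory_recr image_set_mulg set_mulgA -IH image_comp.
exact: trajectory_recr.
Qed.

Lemma trajectory_compact_subgroup n : hausdorff_space G -> compact U ->
  compact (T n.+1) /\ subgroup (T n.+1).
Proof.
move=> hG cU; elim: n => [|n [cT sT]]; first by rewrite trajectory1.
have cphiT : compact (phi @` T n.+1).
  by apply: continuous_compact => //; exact: continuous_subspaceT.
have sphiT : subgroup (phi @` T n.+1) by exact: subgroup_image.
rewrite trajectory_recl; split; first exact: compact_set_mulg.
apply: subgroup_set_mulg => //; apply: quasinormal_mulgC => //.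
exact: compact_closed.
Qed.

Lemma open_trajectory n : open (T n.+1).
Proof.
apply: (open_saturated oU sU); case: n => [|n].
  by rewrite trajectory1 subgroup_mulgg.
by rewrite trajectory_recl set_mulgA subgroup_mulgg.
Qed.

(** By induction, phi^(-n-1)(T_(n+2)) = phi^(-n-1)(T_(n+1)) U, which is
    phi^(-1)(U^(n)) U; quasinormality exchanges the factors and gives
    U^(n+1). *)
Lemma preimage_trajectory n : iter n phi @^-1` T n.+1 = UA n.
Proof.
elim: n => [|n IH]; first by rewrite trajectory1.
rewrite trajectory_recr preimage_set_mulg_image /= preimage_Uapprox_mulgC -IH.
by congr set_mulg; apply/seteqP; split=> x; rewrite /preimage /= -iterS iterSr.
Qed.

End dynamics.

(** * Haar measure and cosets *)

(** Both images are in bijection with the same quotient of A. *)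
Lemma card_eq_image (S V : Type) (W : pointedType) (A : set S)
    (f : S -> V) (g : S -> W) :
  (forall x y, A x -> A y -> f x = f y <-> g x = g y) ->
  (f @` A #= g @` A)%card.
Proof.
move=> fg; pose h v :=
  if pselect (exists2 x, A x & f x = v) is left e then g (projT1 (cid2 e))
  else point.
have hE x : A x -> h (f x) = g x.
  move=> Ax; rewrite /h; case: pselect => [e|[]]; last by exists x.
  by case: (cid2 e) => y Ay /= fyx; apply/fg.
have -> : g @` A = h @` (f @` A).
  by rewrite image_comp; apply: eq_imagel => x Ax /=; rewrite hE.
rewrite card_eq_sym; apply: inj_card_eq.
move=> _ _ /set_mem[x Ax <-] /set_mem[y Ay <-].
by rewrite !hE // => /fg; apply.
Qed.

Section counting.
Variable R : realType.

Lemma counting_finite (S : choiceType) (A : set S) : finite_set A ->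
  counting A = (#|`fset_set A|%:R)%:E :> \bar R.
Proof. by move=> fA; rewrite /counting asboolT. Qed.

Lemma eq_counting (S V : choiceType) (A : set S) (B : set V) :
  finite_set A -> (A #= B)%card -> counting A = counting B :> \bar R.
Proof.
move=> fA AB; have fB : finite_set B by rewrite -(eq_finite_set AB).
by rewrite !counting_finite //; congr (_%:R%:E); apply/(fcard_eq fA fB).
Qed.

End counting.

Section Haar.
Variables (R : realType) (G : topologicalGroupType).
Variable mu : {measure set (borel G) -> \bar R}.
Hypothesis muH : right_Haar mu.

Definition rcosets (H A : set G) : set (set G) :=
  [set set_mulg H [set x] | x in A].

Lemma finite_rcosets (H A : set G) : open H -> subgroup H -> compact A ->
  finite_set (rcosets H A).
Proof.
move=> oH sH cA.
(* Extraction of finite subcovers is stated for pointed spaces, whence this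
   copy of G pointed at its identity. *)
pose PG := HB.pack_for ptopologicalType (TopologicalGroup.sort G)
  (isPointed.Build (TopologicalGroup.sort G) 1%g).
have := cA; rewrite -[compact A]/(@compact PG A) compact_cover.
move=> /(_ G A (fun x => set_mulg H [set x])) [x _||D _ AD].
- exact: open_rcoset.
- by move=> x Ax; exists x => //; exact: rcoset_refl.
apply: (@sub_finite_set _ _ ((fun x => set_mulg H [set x]) @` [set` D])).
  move=> _ [x Ax <-]; have [y Dy /rcosetP Hxy] := AD _ Ax.
  by exists y => //; apply/esym/(rcoset_eqP _ _ sH).
exact: finite_image.
Qed.

Lemma open_borel_measurable (A : set G) :
  open A -> measurable (A : set (borel G)).
Proof. exact: sub_sigma_algebra. Qed.

(** By right invariance all the cosets Hx have the measure of H. *)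
Lemma Haar_rcosets (H A : set G) : open H -> subgroup H -> compact A ->
  set_mulg H A `<=` A -> mu A = (counting (rcosets H A) * mu H)%E.
Proof.
move=> oH sH cA HA; have fC := finite_rcosets oH sH cA.
have mC c : rcosets H A c -> mu c = mu H.
  move=> [x _ <-]; apply: Haar_right_invariant => //.
  exact: open_borel_measurable.
have AE : A = \bigcup_(c in rcosets H A) c.
  apply/seteqP; split=> [x Ax|y [_ [x Ax <-] [h Hh [_ -> <-]]]].
    by exists (set_mulg H [set x]); [exists x|exact: rcoset_refl].
  by apply: HA; exists h => //; exists x.
rewrite [in LHS]AE (measure_fin_bigcup mu fC); first last.
- by move=> _ [x _ <-]; apply: open_borel_measurable; exact: open_rcoset.
- move=> _ _ [x _ <-] [y _ <-] [z [/rcosetP Hzx /rcosetP Hzy]].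
  rewrite -(iffRL (rcoset_eqP _ _ sH) Hzx).
  exact: (iffRL (rcoset_eqP _ _ sH) Hzy).
rewrite counting_finite // (eq_fsbigr (fun=> mu H)); last first.
  by move=> c /set_mem /mC.
rewrite fsbig_finite // big_const_seq count_predT iter_addr.
by rewrite mule_natl addr0.
Qed.

(** If H were null then, for K compact, so would be the compact set HK, which
    consists of finitely many cosets of H; the measure would vanish by inner
    regularity. *)
Lemma Haar_gt0 (H : set G) : hausdorff_space G ->
  open H -> subgroup H -> compact H -> (0 < mu H)%E.
Proof.
move=> hG oH sH cH; rewrite lt_neqAle measure_ge0 andbT eq_sym.
apply/eqP => muH0; have /negP := Haar_neq0 muH; apply.
rewrite eq_le measure_ge0 andbT (Haar_inner muH); last exact: openT.
apply: ub_ereal_sup => _ [K [cK _] <-].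
have KHK : K `<=` set_mulg H K.
  move=> x Kx; exists 1%g; first exact: subgroup1.
  by exists x => //; rewrite mul1g.
have HHK : set_mulg H (set_mulg H K) `<=` set_mulg H K.
  by rewrite set_mulgA subgroup_mulgg.
have cHK : compact (set_mulg H K) by exact: compact_set_mulg.
have := Haar_rcosets oH sH cHK HHK; rewrite muH0 mule0 => <-.
apply: le_measure => //; apply/mem_set.
  rewrite -[K]setCK; apply: measurableC; apply: open_borel_measurable.
  by apply: closed_openC; exact: compact_closed.
apply: open_borel_measurable; exact: (open_saturated oH sH HHK).
Qed.

End Haar.

(** * Exponential growth of the trajectories *)

(** From some rank N + 1 on, ln (b n) is affine in n with slope ln k. *)
Lemma ln_geometric_cvg (R : realType) (b : nat -> R) (k : R) : 0 < k ->
  (forall n, 0 < b n.+1) -> (\forall n \near \oo, b n.+1 = k * b n) ->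
  ln (b n) / n%:R @[n --> \oo] --> ln k.
Proof.
move=> k0 b0 [N _ bS].
have lnb n : ln (b (n + N.+1)%N) = ln (b N.+1) + n%:R * ln k.
  elim: n => [|n IH]; first by rewrite add0n mul0r addr0.
  rewrite addSn bS /=; last by rewrite addnS (leq_trans (leq_addl n N)).
  rewrite lnM ?posrE //; last by rewrite addnS.
  by rewrite IH -natr1; ring.
pose c := ln (b N.+1) - N.+1%:R * ln k.
have cE : \forall n \near \oo, ln k + c * n%:R^-1 = ln (b n) / n%:R.
  exists N.+1 => // n /= Nn; rewrite -(subnK Nn) lnb /c.
  have : (n - N.+1 + N.+1)%:R != 0 :> R.
    by rewrite subnK // pnatr_eq0; case: n Nn.
  rewrite natrD => n0; field.
  by rewrite nat1r.
suff : ln k + c * n%:R^-1 @[n --> \oo] --> ln k + c * 0.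
  by rewrite mulr0 addr0; apply: cvg_trans; exact: near_eq_cvg.
apply: cvgD; first exact: cvg_cst.
apply: cvgM; first exact: cvg_cst.
apply/gtr0_cvgV0; last exact: cvgr_idn.
by exists 1%N => // n n1; rewrite ltr0n.
Qed.

Section growth.
Variables (R : realType) (G : topologicalGroupType).
Variable mu : {measure set (borel G) -> \bar R}.
Variables (phi : {multiplicative G -> G}) (U : set G).
Hypotheses (hG : hausdorff_space G) (muH : right_Haar mu).
Hypotheses (phi_continuous : continuous phi) (sU : subgroup U).
Hypotheses (cU : compact U) (oU : open U) (qU : topologically_quasinormal U).

Local Notation T := (trajectory phi U).
Local Notation W := (phi @^-1` Uminus phi U).

Lemma lcosets_UminusE :
  [set set_mulg [set x] W | x in Uminus phi U] =
  [set set_mulg [set x] W | x in U].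
Proof.
have sW : subgroup W by apply: subgroup_preimage; exact: Uminus_subgroup.
apply/seteqP; split=> [_ [x Ux <-]|_ [x Ux <-]].
  have [u Uu [w Ww <-]] : set_mulg U W x by rewrite -(UminusE phi sU).
  by exists u => //; apply/(lcoset_eqP _ _ sW); rewrite mulKg.
by exists x => //; exact: subset_Uminus.
Qed.

(** The representatives are indexed by inverses, so that left cosets xW on one
    side correspond to right cosets on the other. *)
Lemma rcosets_trajectoryE n :
  rcosets (T n.+1) (T n.+2) =
  [set set_mulg (T n.+1) [set iter n.+1 phi x^-1%g] | x in U].
Proof.
have [_ sT] := trajectory_compact_subgroup phi_continuous sU oU qU n hG cU.
apply/seteqP; split=> [_ [x Tx <-]|_ [x Ux <-]].
  move: Tx; rewrite trajectory_recr => -[t Tt [_ [u Uu <-] <-]].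
  exists u^-1%g; first exact: subgroupV.
  by rewrite invgK; apply/esym/(rcoset_eqP _ _ sT); rewrite mulgK.
exists (iter n.+1 phi x^-1%g) => //; rewrite trajectory_recr.
exists 1%g; first exact: subgroup1.
exists (iter n.+1 phi x^-1%g); last by rewrite mul1g.
by exists x^-1%g => //; exact: subgroupV.
Qed.

(** Both families of cosets are indexed by U.  Points x and y of U give the same
    left coset of W when phi (x^-1 y) is in U^-, and the same right coset of
    T_(n+1) when it is in U^(n), which for large n amounts to the same. *)
Lemma card_rcosets_trajectory : \forall n \near \oo,
  ([set set_mulg [set x] W | x in Uminus phi U] #=
   rcosets (T n.+1) (T n.+2))%card.
Proof.
have := Uapprox_stabilizes phi_continuous sU oU qU cU.
apply: filterS => n stab; rewrite lcosets_UminusE rcosets_trajectoryE.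
have [_ sT] := trajectory_compact_subgroup phi_continuous sU oU qU n hG cU.
have sW : subgroup W by apply: subgroup_preimage; exact: Uminus_subgroup.
apply: card_eq_image => x y Ux Uy.
have Uxy : U (x^-1 * y)%g by apply: subgroupM => //; exact: subgroupV.
have TE z : T n.+1 (iter n.+1 phi z) = Uapprox phi U n (phi z).
  by rewrite iterSr -(preimage_trajectory phi_continuous sU oU qU).
rewrite lcoset_eqP // rcoset_eqP // -multiplicativeV invgK -gmulfM.
rewrite [X in _ <-> X]TE; exact: iff_sym (stab _ Uxy).
Qed.

Lemma mu_trajectory_growth : exists2 k : nat,
  (0 < k)%N /\ group_index R (Uminus phi U) W = k%:R%:E &
  \forall n \near \oo, mu (T n.+2) = (k%:R%:E * mu (T n.+1))%E.
Proof.
have card_eqs := card_rcosets_trajectory.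
pose C := [set set_mulg [set x] W | x in Uminus phi U].
have openT n : open (T n.+1) by exact: open_trajectory.
have TP n := trajectory_compact_subgroup phi_continuous sU oU qU n hG cU.
have finT n : finite_set (rcosets (T n.+1) (T n.+2)).
  by apply: finite_rcosets; [exact: openT|case: (TP n)|case: (TP n.+1)].
have fC : finite_set C.
  have [n _ Cn] := card_eqs.
  by rewrite (eq_finite_set (Cn n (leqnn n))).
exists #|`fset_set C|.
  split; last exact: counting_finite.
  rewrite cardfs_gt0; apply/eqP => /(fset_set_set0 fC).
  move=> /(congr1 (fun A => A (set_mulg [set 1%g] W))) /= C0.
  rewrite -[False]C0; exists 1%g => //.
  by apply: subgroup1; exact: Uminus_subgroup.
move: card_eqs; apply: filterS => n Cn.
have [cT sT] := TP n.
rewrite (Haar_rcosets muH (openT n) sT (TP n.+1).1); last first.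
  by rewrite (trajectory_recr _ _ n.+1) set_mulgA subgroup_mulgg.
by rewrite -(eq_counting R fC Cn) counting_finite.
Qed.

Lemma mu_trajectory_gt0_ltoo n : (0 < mu (T n.+1) < +oo)%E.
Proof.
have [cT sT] := trajectory_compact_subgroup phi_continuous sU oU qU n hG cU.
apply/andP; split; last exact: Haar_compact.
apply: Haar_gt0 => //.
exact: open_trajectory.
Qed.

End growth.

Unset Implicit Arguments.

Theorem proposition4p9 (R : realType) (G : topologicalGroupType)
    (mu : {measure set (borel G) -> \bar R})
    (phi : {multiplicative G -> G}) (U : set G) :
  hausdorff_space G ->
  locally_compact [set: G] ->
  right_Haar mu ->
  continuous phi ->
  subgroup U -> compact U -> open U ->
  topologically_quasinormal U ->
  H_alg mu phi U = lne (group_index R (Uminus phi U) (phi @^-1` Uminus phi U)).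
Proof.
move=> hG _ muH phi_c sU cU oU qU.
have [k [k0 indexE] growth] :=
  mu_trajectory_growth hG muH phi_c sU cU oU qU.
(* T_0 is the trivial group, which is null unless G is discrete; hence the
   restriction to positive ranks. *)
have muT n :
  (fine (mu (trajectory phi U n.+1)))%:E = mu (trajectory phi U n.+1).
  have /andP[mu0 muoo] := mu_trajectory_gt0_ltoo hG muH phi_c sU cU oU qU n.
  by rewrite fineK // ge0_fin_numE // ltW.
have mu0 n : 0 < fine (mu (trajectory phi U n.+1)).
  apply: fine_gt0; exact: (mu_trajectory_gt0_ltoo hG muH phi_c sU cU oU qU n).
rewrite indexE lne_EFin ?ltr0n // /H_alg.
apply: (cvg_limn_einf_sup _).2.
have lim : (ln (fine (mu (trajectory phi U n))) / n%:R)
  @[n --> \oo] --> ln (k%:R : R).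
  apply: ln_geometric_cvg; rewrite ?ltr0n //.
  apply: near_inftyS; apply: filterS growth => n E.
  by apply/EFin_inj; rewrite EFinM !muT.
apply/fine_cvgP.
have lneE n : (lne (mu (trajectory phi U n.+1)) * (n.+1%:R^-1)%:E =
    (ln (fine (mu (trajectory phi U n.+1))) / n.+1%:R)%:E)%E.
  by rewrite -muT lne_EFin.
split; first by apply: near_inftyS; exists 0%N => // n _; rewrite /= lneE.
move: lim; apply: cvg_trans; apply: near_eq_cvg.
by apply: near_inftyS; exists 0%N => // n _; rewrite /= lneE.
Qed.
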